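(* Let $\mathbb{K}$ be a field of characteristic $2$, let $r\in\{2,\dots,\min(n,p)\}$, and let $\mathcal{S}:=\mathrm{S}_r(\mathbb{K})\vee\mathrm{M}_{n-r,p-r}(\mathbb{K})\subset\mathrm{M}_{n,p}(\mathbb{K})$. Let $q\geq 1$. Then the range-preserving group homomorphisms $F:\mathcal{S}\to\mathrm{M}_{n,q}(\mathbb{K})$ are exactly the maps $$M\longmapsto\left(\begin{bmatrix}M & 0_{n\times(q-p)}\end{bmatrix}+\begin{bmatrix}0_{1\times r} & R(m_{1,1})\\ \vdots&\vdots\\ 0_{1\times r} & R(m_{r,r})\\ 0_{(n-r)\times r} & 0_{(n-r)\times(q-r)}\end{bmatrix}\right)Q,$$ where $Q\in\mathrm{GL}_q(\mathbb{K})$ and $R:\mathbb{K}\to\mathrm{M}_{1,q-r}(\mathbb{K})$ is root-linear.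
   Context: $\mathrm{S}_r(\mathbb{K})\vee\mathrm{M}_{n-r,p-r}(\mathbb{K})$ is the set of matrices $\begin{bmatrix}A&C\\0&B\end{bmatrix}$ with $A$ an $r\times r$ symmetric matrix, $B\in\mathrm{M}_{n-r,p-r}(\mathbb{K})$, $C\in\mathrm{M}_{r,p-r}(\mathbb{K})$ arbitrary. A map $F$ is range-preserving when the column space of $F(M)$ equals that of $M$ for all $M$. In characteristic $2$, a map $R$ between $\mathbb{K}$-vector spaces is root-linear when it is additive and $R(\lambda^2x)=\lambda R(x)$ for all $\lambda\in\mathbb{K}$ and all $x$. *)

(* Defs.v *)
From HB Require Import structures.
From mathcomp Require Import all_boot all_order all_algebra.
Set Implicit Arguments. Unset Strict Implicit. Unset Printing Implicit Defensive.
Import GRing.Theory.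
Local Open Scope ring_scope.

Section Defs.
Variable K : fieldType.

Definition mxe {n p : nat} (M : 'M[K]_(n, p)) (i j : nat) : K :=
  match @insub nat (fun k => k < n)%N 'I_n i, @insub nat (fun k => k < p)%N 'I_p j with
  | Some i', Some j' => M i' j'
  | _, _ => 0
  end.

(* M belongs to S_r(K) \vee M_{n-r,p-r}(K): upper-left r x r block symmetric,
   lower-left (n-r) x r block zero, the rest arbitrary *)
Definition inSvM (n p r : nat) (M : 'M[K]_(n, p)) : Prop :=
  (forall i j : nat, (i < r)%N -> (j < r)%N -> mxe M i j = mxe M j i) /\
  (forall (i : 'I_n) (j : 'I_p), (r <= i)%N -> (j < r)%N -> M i j = 0).

Definition additive_on (n p q r : nat) (F : 'M[K]_(n, p) -> 'M[K]_(n, q)) : Prop :=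
  forall M N, inSvM r M -> inSvM r N -> F (M + N) = F M + F N.

(* range-preserving on S: column space of F M equals column space of M
   (column spaces = row spaces of the transposes) *)
Definition range_preserving_on (n p q r : nat) (F : 'M[K]_(n, p) -> 'M[K]_(n, q)) : Prop :=
  forall M, inSvM r M -> ((F M)^T == M^T)%MS.

Definition root_linear (m : nat) (R : K -> 'rV[K]_m) : Prop :=
  (forall x y, R (x + y) = R x + R y) /\
  (forall (l x : K), R (l ^+ 2 * x) = l *: R x).

Definition padmx (n p q : nat) (M : 'M[K]_(n, p)) : 'M[K]_(n, q) :=
  \matrix_(i < n, j < q) mxe M i j.

Definition rootpart (n p q r : nat) (R : K -> 'rV[K]_(q - r)) (M : 'M[K]_(n, p))
  : 'M[K]_(n, q) :=
  \matrix_(i < n, j < q)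
    (if ((i < r) && (r <= j))%N then mxe (R (mxe M i i)) 0 (j - r) else 0).

End Defs.

Arguments mxe {K n p} M i j.
Arguments inSvM {K n p} r M.
Arguments additive_on {K n p q} r F.
Arguments range_preserving_on {K n p q} r F.
Arguments root_linear {K m} R.
Arguments padmx {K n p} q M.
Arguments rootpart {K n p q} r R M.

(* Main.v *)
(* Equality of column spaces means u F(M) = 0 <-> u M = 0 for all row vectors u.
   Applied to the basis vectors, this shows that row i of F(M) depends only on row i of M,
   as a sum of additive functions phi_ik(m_ik).  Applied to combinations of two rows,
   it gives phi_ik(t) = t q_k for i <> k, and phi_ii(t) = t q_i + R(t) with R root-linear, so
   F(M) = M Q0 + D_R(M), where D_R(M) has the rows R(m_ii), i < r.  The key identity is
   u D_R(M) = R(sum u_i^2 m_ii) = R(x A x^T), with x the first r entries of u.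
   The reverse implication u F(M) = 0 -> u M = 0 then forces the rows of Q0 to be independent
   and the span of its last p - r rows and the subspace im R to be disjoint from the span of
   its first r rows, so Q0 extends to an invertible Q whose last q - r rows span
   a space containing im R. *)
Require Import Defs.
From HB Require Import structures.
From mathcomp Require Import all_boot all_order all_algebra ring.
From Stdlib Require Import Classical.
Set Implicit Arguments. Unset Strict Implicit. Unset Printing Implicit Defensive.
Import GRing.Theory.
Local Open Scope ring_scope.

(** * Linear algebra over a field: annihilators, subspaces, completion of bases *)

(** A column space is determined by its left annihilators. For the converse, the test vectors are
    the rows of the transposed cokernel of [B^T], all of which annihilate [B]. *)
Lemma submx_tr_ker (K : fieldType) (m n1 n2 : nat) (A : 'M[K]_(m, n1)) (B : 'M[K]_(m, n2)) :
  (A^T <= B^T)%MS <-> (forall u : 'rV_m, u *m B = 0 -> u *m A = 0).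
Proof.
split=> [/submxP[D /(congr1 trmx)] | kerBA].
  by rewrite trmx_mul !trmxK => -> u uB0; rewrite mulmxA uB0 mul0mx.
rewrite submxE; apply/eqP/trmx_inj; rewrite trmx_mul trmxK trmx0.
apply/row_matrixP=> i; rewrite row_mul row0 kerBA //.
by rewrite -row_mul -[_ *m B]trmxK trmx_mul trmxK mulmx_coker trmx0 row0.
Qed.

Lemma rows_of_rank (F : fieldType) (m q d : nat) (D : 'M[F]_(m, q)) :
  \rank D = d -> exists N : 'M_(d, q), (N :=: D)%MS.
Proof. by move=> <-; exists (row_base D); apply: eq_row_base. Qed.

(** As long as some vector of [P] lies outside [G], adding it raises the rank, which [q] bounds; [k]
    bounds the remaining codimension. This turns the image of a root-linear map into a row space. *)
Lemma subspace_rowspace (F : fieldType) (q : nat) (P : 'rV[F]_q -> Prop) :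
    P 0 -> (forall u v, P u -> P v -> P (u + v)) -> (forall a u, P u -> P (a *: u)) ->
  exists G : 'M_q, forall v, P v <-> (v <= G)%MS.
Proof.
move=> P0 PD PZ.
suff H k : forall G : 'M_q, (q - \rank G <= k)%N -> (forall v, (v <= G)%MS -> P v) ->
    exists G : 'M_q, forall v, P v <-> (v <= G)%MS.
  apply: (H q 0); first by rewrite leq_subr.
  by move=> v; rewrite submx0 => /eqP->.
elim: k => [|k IHk] G rG GP;
  case: (classic (forall v, P v -> (v <= G)%MS)) => [PG | /not_all_ex_not[v nPG]];
  try (by exists G => v; split; auto).
  case: nPG => _; apply: submx_full; rewrite /row_full eqn_leq rank_leq_col.
  by rewrite -subn_eq0 -leqn0.
have [Pv nvG] := imply_to_and _ _ nPG.
have ltG : (G < G + v)%MS.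
  by rewrite /ltmx addsmxSl; apply/negP=> sG; apply: nvG; apply: submx_trans sG; apply: addsmxSr.
apply: (IHk (G + v)%MS).
  move: (rank_ltmx ltG) rG (rank_leq_col (G + v)%MS); rewrite leq_subLR.
  by move=> h1 h2 _; rewrite leq_subLR (leq_trans h2) // addnS -addSn leq_add2r.
move=> w /sub_addsmxP[[a b] /= ->]; apply: PD; first by apply/GP/submxMl.
by rewrite (mx11_scalar b) mul_scalar_mx; apply: PZ.
Qed.

(** The space [W], spanned by [B], [G] and a complement of [U + B + G], is a complement of [U]: the
    hypothesis on [G] says that [U] meets [B + G] trivially. Completing [B] to a basis of [W] gives
    [N], and [G] lies in [W]. *)
Lemma extend_rows (F : fieldType) (r s d : nat) (U : 'M[F]_(r, r + s + d))
    (B : 'M[F]_(s, r + s + d)) (G : 'M[F]_(r + s + d)) :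
    row_free (col_mx U B) ->
    (forall y z, ((y *m U + z *m B)%R <= G)%MS -> y = 0 :> 'rV_r) ->
  exists N : 'M[F]_(d, r + s + d), col_mx (col_mx U B) N \in unitmx /\
    forall v : 'rV_(r + s + d), (v <= G)%MS ->
      exists w : 'rV_(s + d), v = w *m col_mx B N.
Proof.
move=> freeUB yG0.
set T := (U + (B + G))%MS; set W := (B + G + T^C)%MS.
have UW0 : (U :&: W)%MS = 0.
  apply/eqP/rowV0P=> v; rewrite sub_capmx => /andP[/submxP[y vE]].
  case/sub_addsmxP=> -[b c] /= vE2.
  (* Both [v] and its part in [B + G] lie in [T], so the part in [T^C] vanishes. *)
  have c0 : c *m T^C%MS = 0.
    apply/eqP; rewrite -submx0 -(capmx_compl T) sub_capmx submxMl andbT.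
    have -> : c *m T^C%MS = v - b *m (B + G)%MS by rewrite vE2 addrC addKr.
    rewrite addmx_sub ?eqmx_opp //; first by rewrite vE (submx_trans (submxMl _ _)) ?addsmxSl.
    by rewrite (submx_trans (submxMl _ _)) ?addsmxSr.
  have : (v <= B + G)%MS by rewrite vE2 c0 addr0 submxMl.
  case/sub_addsmxP=> -[z g] /= vE3; rewrite vE (yG0 y (- z)) ?mul0mx //.
  by rewrite -vE vE3 mulNmx addrAC subrr add0r submxMl.
have UWfull : \rank (U + W)%MS = (r + s + d)%N.
  apply/eqP; rewrite -/(row_full _) -sub1mx.
  rewrite (submx_trans _ (_ : (T + T^C <= _)%MS)) ?sub1mx ?addsmx_compl_full //.
  by rewrite addsmxA.
have freeU : \rank U = r /\ \rank B = s.
  have := eqP freeUB; rewrite -addsmxE => rUB.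
  have := mxrank_adds_leqif U B; case=> le _; rewrite rUB in le.
  have lU := rank_leq_row U; have lB := rank_leq_row B.
  split; apply/eqP; rewrite eqn_leq ?lU ?lB /=.
    by rewrite -(leq_add2r s) (leq_trans le) // leq_add2l.
  by rewrite -(leq_add2l r) (leq_trans le) // leq_add2r.
case: freeU => rU rB.
have rW : \rank W = (s + d)%N.
  have := mxrank_sum_cap U W; rewrite UW0 mxrank0 UWfull rU addn0 => e.
  by apply: (@addnI r); rewrite addnA.
have sBW : (B <= W)%MS by rewrite /W -addsmxA addsmxSl.
have rD : \rank (W :\: B)%MS = d.
  have := mxrank_cap_compl W B; rewrite rW (capmx_idPr sBW) rB.
  exact: addnI.
have [N eN] := rows_of_rank rD.
have sWN : (W <= col_mx B N)%MS.
  rewrite -addsmxE (adds_eqmx (eqmx_refl B) eN) -(addsmx_diff_cap_eq W B).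
  by rewrite addsmx_sub addsmxSr (submx_trans (capmxSr _ _)) ?addsmxSl.
exists N; split; last first.
  move=> v vG; apply/submxP; apply: submx_trans sWN; apply: submx_trans vG _.
  by rewrite /W (submx_trans _ (addsmxSl _ _)) ?addsmxSr.
rewrite -row_full_unit -sub1mx.
have full1 : (1%:M <= U + W)%MS by rewrite sub1mx /row_full; apply/eqP.
have sUB : (col_mx U B <= col_mx (col_mx U B) N)%MS by rewrite -(addsmxE _ N) addsmxSl.
have sN : (N <= col_mx (col_mx U B) N)%MS by rewrite -(addsmxE _ N) addsmxSr.
move: sUB; rewrite -(addsmxE U B) addsmx_sub => /andP[sU sB].
apply: submx_trans full1 _; rewrite addsmx_sub sU.
by apply: submx_trans sWN _; rewrite -addsmxE addsmx_sub sB.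
Qed.

(** * Entries and the space of block matrices *)

Lemma mxeE (K : fieldType) (n p : nat) (M : 'M[K]_(n, p)) (i : 'I_n) (j : 'I_p) :
  mxe M i j = M i j.
Proof. by rewrite /mxe !valK. Qed.

Lemma mxeD (K : fieldType) (n p : nat) (M N : 'M[K]_(n, p)) (i j : nat) :
  mxe (M + N) i j = mxe M i j + mxe N i j.
Proof.
rewrite /mxe; case: (insub i : option 'I_n) => [a|]; last by rewrite addr0.
by case: (insub j : option 'I_p) => [b|]; rewrite ?addr0 ?mxE.
Qed.

Lemma inSvMD (K : fieldType) (n p r : nat) (M N : 'M[K]_(n, p)) :
  inSvM r M -> inSvM r N -> inSvM r (M + N).
Proof.
move=> [symM zM] [symN zN]; split=> [i j ir jr | i j ri jr].
  by rewrite !mxeD (symM i j) ?(symN i j).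
by rewrite mxE zM ?zN ?addr0.
Qed.

Lemma inSvM0 (K : fieldType) (n p r : nat) : inSvM r (0 : 'M[K]_(n, p)).
Proof.
have mxe0 i j : mxe (0 : 'M[K]_(n, p)) i j = 0.
  by apply: (addrI (mxe (0 : 'M[K]_(n, p)) i j)); rewrite -mxeD !addr0.
by split=> *; rewrite ?mxe0 ?mxE.
Qed.

Lemma inSvM_sum (K : fieldType) (n p r : nat) (I : finType) (G : I -> 'M[K]_(n, p)) :
  (forall i, inSvM r (G i)) -> inSvM r (\sum_i G i).
Proof.
move=> GS; apply: (big_ind (fun M => inSvM r M)) => //; first exact: inSvM0.
by move=> M N; apply: inSvMD.
Qed.

(** * Root-linear maps applied to the diagonal *)

(** This is [D_R(M)], with [R] valued in rows of full length, so that it makes sense before the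
    basis [Q] is chosen; [rootpart] is the case where [R] is padded with [r] zeros in front. *)
Definition diagrows (K : fieldType) (n p m r : nat) (R : K -> 'rV[K]_m)
    (M : 'M[K]_(n, p)) : 'M_(n, m) :=
  \matrix_(i, c) (if (i < r)%N then R (mxe M i i) 0 c else 0).

Lemma root_linear0 (K : fieldType) (m : nat) (R : K -> 'rV[K]_m) :
  root_linear R -> R 0 = 0.
Proof. by move=> [_ RZ]; rewrite -[X in R X](mulr0 (0 ^+ 2)) RZ scale0r. Qed.

Lemma root_linear_sum (K : fieldType) (m : nat) (R : K -> 'rV[K]_m) (I : finType)
    (P : pred I) (f : I -> K) :
  root_linear R -> R (\sum_(i | P i) f i) = \sum_(i | P i) R (f i).
Proof.
by move=> RL; apply: (big_morph R); [case: RL | apply: root_linear0].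
Qed.

(** Each weight [u_i] enters [R] as [u_i^2], so a combination of rows becomes a single value of
    [R]. *)
Lemma mul_diagrows (K : fieldType) (n p m r : nat) (R : K -> 'rV[K]_m)
    (u : 'rV_n) (M : 'M[K]_(n, p)) :
  root_linear R ->
  u *m diagrows r R M = R (\sum_(i < n | (i < r)%N) u 0 i ^+ 2 * mxe M i i).
Proof.
move=> RL; apply/rowP=> c; rewrite root_linear_sum // mxE summxE [RHS]big_mkcond.
apply: eq_bigr => i _; rewrite !mxE; case: ifP => _; last by rewrite mulr0.
by case: RL => _ ->; rewrite mxE.
Qed.

(** * Quadratic form and left kernels in characteristic 2 *)

Section Char2.
Variable K : fieldType.
Hypothesis hchar : 2%N \in [pchar K].

Lemma addr_eq0_pchar2 (x y : K) : x + y = 0 -> x = y.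
Proof. by move/eqP; rewrite addr_eq0 (oppr_pchar2 hchar) => /eqP. Qed.

(** The strictly upper part [U] and the strictly lower part [L] have equal sums, which cancel in
    characteristic 2. *)
Lemma sum_sym_pchar2 (m : nat) (f : 'I_m -> 'I_m -> K) :
  (forall i j, f i j = f j i) -> \sum_i \sum_j f i j = \sum_i f i i.
Proof.
move=> fC.
have split_f i j : f i j = (if (i < j)%N then f i j else 0) +
    ((if (j < i)%N then f i j else 0) + (if j == i then f i j else 0)).
  by rewrite -val_eqE; case: ltngtP => /=; rewrite ?addr0 ?add0r.
pose U (i : 'I_m) := \sum_(j < m) (if (i < j)%N then f i j else 0).
pose L (i : 'I_m) := \sum_(j < m) (if (j < i)%N then f i j else 0).
transitivity (\sum_i (U i + (L i + f i i))).
  apply: eq_bigr => i _; under eq_bigr => j _ do rewrite split_f.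
  by rewrite !big_split /= -[X in _ + (_ + X)]big_mkcond big_pred1_eq.
rewrite !big_split /= addrA (_ : \sum_i U i = \sum_i L i) ?addrr_pchar2 ?add0r //.
rewrite [LHS]exchange_big; apply: eq_bigr => i _; apply: eq_bigr => j _.
by rewrite fC.
Qed.

(* In characteristic 2 the left-hand side is x A x^T, for x the first r entries of u
   and A the symmetric block of M. *)
Lemma quadratic_form_inSvM (n p r : nat) (u : 'rV_n) (M : 'M[K]_(n, p)) :
    (r <= p)%N -> inSvM r M ->
    (forall k : 'I_p, (k < r)%N -> (u *m M) 0 k = 0) ->
  \sum_(i < n | (i < r)%N) u 0 i ^+ 2 * mxe M i i = 0.
Proof.
move=> rp [symM zM] uM0.
pose f (i j : 'I_n) :=
  if (i < r)%N && (j < r)%N then u 0 i * u 0 j * mxe M i j else 0.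
transitivity (\sum_i f i i).
  by rewrite [LHS]big_mkcond; apply: eq_bigr => i _; rewrite /f andbb expr2.
rewrite -sum_sym_pchar2 => [|i j]; last first.
  by rewrite /f andbC; case: andP => // -[jr ir]; rewrite symM // [u 0 i * _]mulrC.
apply: big1 => i _; have [ir | ri] := ltnP i r; last first.
  by apply: big1 => j _; rewrite /f ltnNge ri.
(* By symmetry the inner sum over [j] is [u_i] times entry [i] of [u M]; the rows [j >= r] add
   nothing because the lower-left block is zero. *)
have := uM0 (Ordinal (leq_trans ir rp)) ir; rewrite mxE.
move/(congr1 (fun z => u 0 i * z)); rewrite mulr0 mulr_sumr => sum0.
rewrite -[RHS]sum0; apply: eq_bigr => j _; rewrite /f ir /=.
have [jr | rj] := ltnP j r; last by rewrite zM ?mulr0.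
by rewrite symM // -mulrA -(mxeE M).
Qed.

(** If [u] kills the image, [u M Q0] is a value of [R], so [sepR] clears the first [r] entries of
    [u M]. The quadratic form then vanishes, hence so does that value of [R], and [freeQ0] yields
    [u M = 0]. *)
Lemma diagrows_ker (n p q r : nat) (Q0 : 'M_(p, q)) (R : K -> 'rV[K]_q) :
    (r <= p)%N -> root_linear R ->
    (forall (y : 'rV_p) t, y *m Q0 = R t -> forall k : 'I_p, (k < r)%N -> y 0 k = 0) ->
    (forall y : 'rV_p, y *m Q0 = 0 -> y = 0) ->
  forall (M : 'M_(n, p)) (u : 'rV_n), inSvM r M ->
    (u *m (M *m Q0 + diagrows r R M) == 0) = (u *m M == 0).
Proof.
move=> rp RL sepR freeQ0 M u SM.
rewrite mulmxDr mulmxA mul_diagrows // addr_eq0; apply/eqP/eqP => [uF0 | uM0].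
  have yR : u *m M *m Q0 = R (\sum_(i < n | (i < r)%N) u 0 i ^+ 2 * mxe M i i).
    rewrite uF0; apply/rowP=> c; rewrite !mxE; exact: (oppr_pchar2 hchar).
  apply: freeQ0; rewrite yR quadratic_form_inSvM ?root_linear0 //.
  exact: sepR yR.
rewrite uM0 mul0mx quadratic_form_inSvM ?root_linear0 ?oppr0 //.
by move=> k _; rewrite uM0 mxE.
Qed.

End Char2.

(** * Row-by-row behaviour of a range-preserving homomorphism *)

Section Structure.
Variables (K : fieldType) (n p q r : nat).
Hypothesis hchar : 2%N \in [pchar K].
Hypotheses (hr2 : (2 <= r)%N) (hrn : (r <= n)%N) (hrp : (r <= p)%N).
Variable F : 'M[K]_(n, p) -> 'M[K]_(n, q).
Hypothesis FD : additive_on r F.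
Hypothesis Fker : forall (M : 'M_(n, p)) (u : 'rV_n), inSvM r M ->
  (u *m F M == 0) = (u *m M == 0).

Let addxx (x : K) : x + x = 0. Proof. exact: addrr_pchar2. Qed.

Lemma hom0 : F 0 = 0.
Proof.
by apply: (addrI (F 0)); rewrite -FD ?addr0 //; apply: inSvM0.
Qed.

Lemma hom_sum (I : finType) (G : I -> 'M[K]_(n, p)) :
  (forall i, inSvM r (G i)) -> F (\sum_i G i) = \sum_i F (G i).
Proof.
move=> GS; suff [] : inSvM r (\sum_i G i) /\ F (\sum_i G i) = \sum_i F (G i) by [].
apply: (big_ind2 (fun A B => inSvM r A /\ F A = B)) => //.
- by split; [apply: inSvM0 | apply: hom0].
- move=> A _ B _ [SA <-] [SB <-]; rewrite FD //; split=> //; exact: inSvMD.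
Qed.

(** The kernel condition for [u = a e_i + b e_j]; the relations between the functions [phi] below
    all come from it. *)
Lemma hom_rows2 (M : 'M_(n, p)) (i j : 'I_n) (a b : K) : inSvM r M ->
  (forall c, a * M i c + b * M j c = 0) <-> (forall c, a * F M i c + b * F M j c = 0).
Proof.
move=> SM; pose u := a *: delta_mx 0 i + b *: delta_mx 0 j : 'rV_n.
have uE m (N : 'M_(n, m)) : (u *m N == 0) <-> (forall c, a * N i c + b * N j c = 0).
  have -> : u *m N = a *: row i N + b *: row j N by rewrite mulmxDl -!scalemxAl -!rowE.
  split=> [/eqP/rowP uN c | uN]; first by have := uN c; rewrite !mxE.
  by apply/eqP/rowP=> c; rewrite !mxE.
by rewrite -uE -uE Fker.
Qed.

(** In characteristic 2 row [i] of [M + N] is zero, hence so is row [i] of [F M + F N]. *)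
Lemma hom_row (M N : 'M_(n, p)) (i : 'I_n) : inSvM r M -> inSvM r N ->
  (forall b, M i b = N i b) -> forall c, F M i c = F N i c.
Proof.
move=> SM SN eqMN c; apply: (addr_eq0_pchar2 hchar).
have [+ _] := @hom_rows2 (M + N) i i 1 0 (inSvMD SM SN) => /(_ _ c).
rewrite FD // !mxE mul1r mul0r addr0; apply=> b.
by rewrite !mxE mul1r mul0r addr0 eqMN addxx.
Qed.

(* The symmetrized elementary matrix t(E_ik + E_ki) for i <> k < r, and t E_ik when
   i = k or r <= k. *)
Definition symE (i k : nat) (t : K) : 'M[K]_(n, p) := \matrix_(a, b)
  (if (a == i :> nat) && (b == k :> nat) || [&& (k < r)%N, a == k :> nat & b == i :> nat]
   then t else 0).

(** The hypothesis excludes exactly the positions of the zero block. *)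
Lemma symE_in (i k : nat) (t : K) : (r <= k)%N || (i < r)%N -> inSvM r (symE i k t).
Proof.
move=> ik; split=> [a b ar br | a b ra br].
  have an := leq_trans ar hrn; have ap := leq_trans ar hrp.
  have bn := leq_trans br hrn; have bp := leq_trans br hrp.
  have -> := mxeE (symE i k t) (Ordinal an) (Ordinal bp).
  have -> := mxeE (symE i k t) (Ordinal bn) (Ordinal ap).
  rewrite !mxE /=; congr (if _ then _ else _).
  case: ltnP => kr; first by rewrite /= orbC ![(a == _) && _]andbC.
  by rewrite !orbF (ltn_eqF (leq_trans br kr)) (ltn_eqF (leq_trans ar kr)) !andbF.
rewrite mxE; case: ifP => // /orP[/andP[/eqP ai /eqP bk] | /and3P[kr /eqP ak _]].
  by move: ik; rewrite -ai -bk leqNgt br /= ltnNge ra.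
by move: ra; rewrite ak leqNgt kr.
Qed.

Lemma symE_sym (i k : nat) (t : K) : (i < r)%N -> (k < r)%N -> symE i k t = symE k i t.
Proof. by move=> ir kr; apply/matrixP=> a b; rewrite !mxE ir kr /= orbC. Qed.

Lemma symED (i k : nat) (s t : K) : symE i k (s + t) = symE i k s + symE i k t.
Proof. by apply/matrixP=> a b; rewrite !mxE; case: ifP; rewrite ?addr0. Qed.

Lemma symE0 (i k : nat) : symE i k 0 = 0.
Proof. by apply/matrixP=> a b; rewrite !mxE if_same. Qed.

(** * The entry functions of F and their relations *)

(** Row [i] of [symE i k t] is [t e_k], so this is the contribution of the entry [m_ik = t] to row
    [i] of [F M]. *)
Definition phi (i : 'I_n) (k : nat) (t : K) (c : 'I_q) : K := F (symE i k t) i c.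

Lemma phiD (i : 'I_n) (k : nat) (s t : K) (c : 'I_q) : (r <= k)%N || (i < r)%N ->
  phi i k (s + t) c = phi i k s c + phi i k t c.
Proof. by move=> ik; rewrite /phi symED FD ?mxE //; apply: symE_in. Qed.

Lemma hom_row0 (i k : nat) (j : 'I_n) (t : K) (c : 'I_q) : (r <= k)%N || (i < r)%N ->
  j != i :> nat -> (r <= k)%N || (j != k :> nat) -> F (symE i k t) j c = 0.
Proof.
move=> ik ji jk; rewrite (@hom_row _ 0) ?hom0 ?mxE //; [exact: symE_in|exact: inSvM0|].
move=> b; rewrite !mxE (negPf ji) /=; case: ifP => // /and3P[kr /eqP jk' _].
by move: jk; rewrite leqNgt kr jk' eqxx.
Qed.

(** In [symE i k t + symE j k s], rows [i] and [j] are [t e_k] and [s e_k], so [s] times the first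
    plus [t] times the second is [2 s t e_k = 0]. Any symmetric counterparts lie in row [k],
    distinct from both. *)
Lemma phi_offdiag (i j : 'I_n) (k : nat) (s t : K) (c : 'I_q) : i != j ->
  (r <= k)%N || [&& (i < r)%N, (j < r)%N, i != k :> nat & j != k :> nat] ->
  s * phi i k t c = t * phi j k s c.
Proof.
move=> ij hk; have ij' : (i == j :> nat) = false by apply/negbTE.
have Sik : (r <= k)%N || (i < r)%N by case/orP: hk => [->|/and4P[->]]; rewrite ?orbT.
have Sjk : (r <= k)%N || (j < r)%N by case/orP: hk => [->|/and4P[_ ->]]; rewrite ?orbT.
have ik : (r <= k)%N || (i != k :> nat) by case/orP: hk => [->|/and4P[_ _ ->]]; rewrite ?orbT.
have jk : (r <= k)%N || (j != k :> nat) by case/orP: hk => [->|/and4P[_ _ _ ->]]; rewrite ?orbT.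
have noti (b : 'I_p) (l : 'I_n) : (r <= k)%N || (l != k :> nat) -> forall m : nat,
  [&& (k < r)%N, l == k :> nat & b == m :> nat] = false.
  by move=> + m; rewrite leqNgt; case: (k < r)%N => //= /negPf->.
pose M := symE i k t + symE j k s.
have SM : inSvM r M by apply: inSvMD; apply: symE_in.
have [+ _] := hom_rows2 i j s t SM => /(_ _ c).
rewrite FD ?mxE; try exact: symE_in.
have -> : F (symE j k s) i c = 0 by apply: hom_row0; rewrite ?ij'.
have -> : F (symE i k t) j c = 0 by apply: hom_row0; rewrite // eq_sym ij'.
rewrite addr0 add0r => H; apply: (addr_eq0_pchar2 hchar); apply: H => b.
rewrite !mxE !noti // !eqxx ij' [j == i :> nat]eq_sym ij' /= !orbF.
by case: (b == k :> nat); rewrite ?addr0 ?add0r ?mulr0 ?addr0 // mulrC addxx.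
Qed.

(* In characteristic 2 the row vector (x, 1) annihilates the symmetric block
   [[a, x a], [x a, x^2 a]]. *)
Lemma phi_square (i j : 'I_n) (x a : K) (c : 'I_q) : i != j -> (i < r)%N -> (j < r)%N ->
  x * phi i i a c + x * phi i j (x * a) c
    + (phi j i (x * a) c + phi j j (x ^+ 2 * a) c) = 0.
Proof.
move=> ij ir jr; have ij' : (i == j :> nat) = false by apply/negbTE.
have S k l t : (k < r)%N -> inSvM r (symE k l t) by move=> kr; apply: symE_in; rewrite kr orbT.
pose M := symE i i a + (symE i j (x * a) + symE j j (x ^+ 2 * a)).
have SM : inSvM r M by do 2?apply: inSvMD; apply: S.
have [+ _] := hom_rows2 i j x 1 SM => /(_ _ c).
rewrite !FD ?mxE; try (by repeat apply: inSvMD; apply: S).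
have -> : F (symE i i a) j c = 0 by apply: hom_row0; rewrite ?ir ?orbT // eq_sym ij' ?orbT.
have -> : F (symE j j (x ^+ 2 * a)) i c = 0 by apply: hom_row0; rewrite ?jr ?orbT // ij' ?orbT.
(* On row [j] the symmetric matrix is read as [symE j i (x * a)], which produces [phi j i]. *)
rewrite {2}symE_sym // addr0 add0r mul1r mulrDr; apply=> b.
rewrite !mxE !eqxx ij' [j == i :> nat]eq_sym ij' ir jr /= !orbb !orbF.
case: (eqVneq (b : nat) i) => [->|bi] /=; rewrite ?ij' ?orbF.
  by rewrite !addr0 add0r mul1r addxx.
case: (b == j :> nat) => /=; rewrite ?addr0 ?add0r ?mulr0 ?addr0 //.
by rewrite mul1r expr2 mulrA addxx.
Qed.

(* Polarize phi_square in x: every term but [x * phi i j (x * a)] is additive in x. *)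
Lemma phi_linear (i j : 'I_n) (x a : K) (c : 'I_q) : i != j -> (i < r)%N -> (j < r)%N ->
  phi i j (x * a) c = x * phi i j a c.
Proof.
move=> ij ir jr.
have phiD' (k : 'I_n) l s t : (k < r)%N -> phi k l (s + t) c = phi k l s c + phi k l t c.
  by move=> kr; apply: phiD; rewrite kr orbT.
have := phi_square (1 + x) a c ij ir jr; have := phi_square x a c ij ir jr.
have := phi_square 1 a c ij ir jr.
have -> : (1 + x) ^+ 2 * a = a + x ^+ 2 * a.
  by rewrite sqrrD expr1n mul1r mulr2n addxx addr0 mulrDl mul1r.
rewrite expr1n ![(1 + x) * a]mulrDl !mul1r !phiD' //.
move: (phi i i a c) (phi i j a c) (phi i j (x * a) c) (phi j i a c) (phi j i (x * a) c)
  (phi j j a c) (phi j j (x ^+ 2 * a) c) => P g gx h hx d dx e1 ex e1x.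
apply: (addr_eq0_pchar2 hchar).
(* The sum of the relations for [1 + x], [x] and [1] differs from the goal by a multiple of 2. *)
transitivity ((1 + x) * P + (1 + x) * (g + gx) + (h + hx + (d + dx))
    + (x * P + x * gx + (hx + dx)) + (P + g + (h + d))
    - (1 + 1) * (P + x * P + g + x * gx + h + hx + d + dx)); first by ring.
by rewrite e1 ex e1x (addxx 1) mul0r subr0 !addr0.
Qed.

(** * The rows q_k and the root-linear map R *)

Lemma n_gt1 : (1 < n)%N. Proof. exact: leq_trans hrn. Qed.
Let o0 : 'I_n := Ordinal (ltnW n_gt1).
Let o1 : 'I_n := Ordinal n_gt1.

(** The row used to read off [q_k] only has to differ from [k]: row 0, or row 1 when [k = 0]. *)
Definition qrow (k : nat) : 'I_q -> K := phi (if k == 0%N then o1 else o0) k 1.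
(** The defect of linearity [phi_00(t) - t q_0], with the sign dropped in characteristic 2. *)
Definition rootrow (t : K) : 'rV[K]_q := \row_c (phi o0 0 t c + t * qrow 0 c).

(** [phi_offdiag] compares row [i] with the reference row [j] used by [qrow]. When [i = j] and
    [r <= k], the comparison passes through another row [l] and back. *)
Lemma phi_offdiagE (i : 'I_n) (k : nat) (t : K) (c : 'I_q) :
  (r <= k)%N || [&& (i < r)%N, (k < r)%N & i != k :> nat] -> phi i k t c = t * qrow k c.
Proof.
move=> ik; set j := if k == 0%N then o1 else o0.
have jr : (j < r)%N by rewrite /j; case: ifP => // _; apply: ltnW.
have jk : (r <= k)%N || (j != k :> nat).
  by rewrite /j; have [-> | k0] := eqVneq k 0%N; rewrite ?orbT // eq_sym k0 orbT.
have moved (l : 'I_n) : i != l ->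
    (r <= k)%N || [&& (l < r)%N & l != k :> nat] -> phi i k t c = t * phi l k 1 c.
  move=> il lk; rewrite -[LHS]mul1r; apply: phi_offdiag => //.
  by case/orP: ik lk => [->|/and3P[-> kr ->]] //; rewrite leqNgt kr.
have [ij | ij] := eqVneq i j; last by apply: moved; rewrite ?jr.
have [rk | kr] := leqP r k.
  have [l il] : exists l : 'I_n, i != l.
    by exists (if k == 0%N then o0 else o1); rewrite ij /j; case: ifP.
  rewrite (moved l il) ?rk // /qrow -/j -ij; congr (_ * _).
  by rewrite -[LHS]mul1r -[RHS]mul1r; apply: phi_offdiag; rewrite ?rk // eq_sym.
(* For [k < r] and [r = 2] no other row can be compared with [j], so homogeneity is taken from
   [phi_linear]. *)
have kn := leq_trans kr hrn; rewrite /qrow -/j -ij -[t in LHS]mulr1.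
apply: (@phi_linear i (Ordinal kn)) => //; last by rewrite ij.
by move: ik; rewrite leqNgt kr => /= /andP[].
Qed.

(** [phi_square] on rows 0 and [i] with [x = 1] shows that [phi_ii(t) - t q_i] is the same for every
    [i]. *)
Lemma phi_diagE (i : 'I_n) (t : K) (c : 'I_q) : (i < r)%N ->
  phi i i t c = t * qrow i c + rootrow t 0 c.
Proof.
move=> ir; rewrite mxE; have [-> | i0] := eqVneq i o0.
  by rewrite addrCA addxx addr0.
have i0' : (i != 0 :> nat) by [].
have r0 : (0 < r)%N by apply: ltnW.
have := @phi_square o0 i 1 t c; rewrite eq_sym expr1n !mul1r => /(_ i0 r0 ir).
rewrite [phi o0 i _ _]phi_offdiagE ?[phi i o0 _ _]phi_offdiagE ?ir ?r0 ?i0' ?orbT // 1?eq_sym ?i0' ?orbT //.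
move: (phi i i t c) (phi o0 o0 t c) => d P e.
apply: (addr_eq0_pchar2 hchar); rewrite -[RHS]e; ring.
Qed.

(** Scaling comes from [phi_square] on rows 0 and 1, where the two terms [l^2 a q_1] cancel. *)
Lemma rootrow_linear : root_linear rootrow.
Proof.
have r0 : (0 < r)%N by apply: ltnW.
split=> [x y | l a]; apply/rowP=> c; rewrite !mxE.
  by rewrite phiD ?r0 ?orbT // mulrDl; ring.
have := @phi_square o0 o1 l a c isT r0 hr2.
rewrite [phi o0 o1 _ _]phi_offdiagE ?[phi o1 o0 _ _]phi_offdiagE ?hr2 ?r0 ?orbT //.
rewrite [phi o1 o1 _ _]phi_diagE // mxE => e.
apply: (addr_eq0_pchar2 hchar).
move: e; set P := phi o0 0 a c; set P' := phi o0 0 (l ^+ 2 * a) c.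
move: (qrow o0 c) (qrow o1 c) => a0 a1 e.
transitivity (0 - (1 + 1) * (l ^+ 2 * a * a1)); last by rewrite addxx mul0r subrr.
by rewrite -e; ring.
Qed.

Lemma inSvM_row (M : 'M[K]_(n, p)) (i : 'I_n) (b : 'I_p) : inSvM r M ->
  M i b = 0 \/ (r <= b)%N || (i < r)%N.
Proof.
move=> [_ zM]; case: (leqP r b) => rb; first by right.
by case: (ltnP i r) => ri; [right | left; apply: zM].
Qed.

(** Row [i] of [M] is also row [i] of [N], a sum of matrices [symE i b (M i b)] in the space; hence
    row [i] of [F M] is the sum of the [phi_ib(m_ib)]. *)
Lemma hom_structure (M : 'M_(n, p)) : inSvM r M ->
  F M = M *m (\matrix_(k < p, c < q) qrow k c) + diagrows r rootrow M.
Proof.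
move=> SM; apply/matrixP=> i c; pose N := \sum_(b < p) symE i b (M i b).
have SE (b : 'I_p) : inSvM r (symE i b (M i b)).
  by have [-> | ib] := inSvM_row i b SM; [rewrite symE0; apply: inSvM0 | apply: symE_in].
have SN : inSvM r N by apply: inSvM_sum.
have -> : F M i c = F N i c.
  apply: hom_row => // b; rewrite summxE (bigD1 b) //= mxE !eqxx /= big1 ?addr0 //.
  move=> k kb; rewrite mxE eqxx /= [b == k :> nat]eq_sym (negPf (kb : k != b :> nat)) /=.
  by case: ifP => // /and3P[_ /eqP ik /eqP bi]; move: kb; rewrite -val_eqE /= -ik bi eqxx.
rewrite hom_sum // summxE !mxE.
have termE (b : 'I_p) : F (symE i b (M i b)) i c =
    M i b * qrow b c + (if ((i < r)%N && (b == i :> nat)) then rootrow (M i b) 0 c else 0).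
  have [-> | ib] := inSvM_row i b SM.
    by rewrite symE0 hom0 mxE mul0r add0r root_linear0 ?mxE ?if_same //; apply: rootrow_linear.
  case: ifP => [/andP[ir /eqP bi] | nbi]; first by have := phi_diagE (M i b) c ir; rewrite /phi -bi.
  rewrite addr0; apply: phi_offdiagE; case: (leqP r b) ib => //= rb ir.
  by rewrite ir /=; move: nbi; rewrite ir /= eq_sym => ->.
rewrite (eq_bigr _ (fun b _ => termE b)) big_split /=; congr (_ + _).
  by apply: eq_bigr => b _; rewrite !mxE.
have [ir | _] := ifP; last by rewrite big1.
have ip := leq_trans ir hrp.
rewrite (bigD1 (Ordinal ip)) //= eqxx big1 ?addr0 => [|b bi].
  by rewrite -(mxeE M) mxE.
by rewrite -val_eqE /= in bi; rewrite (negPf bi).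
Qed.

(** * Independence of the rows of Q0 and separation from the image of R *)

(** Row [i] is [z], and the first [r] entries of [z] are copied down column [i] for symmetry: any
    [z] thus occurs as row [i < r] of a matrix of the space. *)
Definition crossmx (i : 'I_n) (z : 'rV[K]_p) : 'M[K]_(n, p) := \matrix_(a, b)
  (if a == i then z 0 b else if (a < r)%N && (b == i :> nat) then mxe z 0 a else 0).

Lemma crossmx_in (i : 'I_n) (z : 'rV_p) : (i < r)%N -> inSvM r (crossmx i z).
Proof.
move=> ir; split=> [a b ar br | a b ra br]; last first.
  rewrite mxE ltnNge ra; case: eqP => // ai.
  by move: ra; rewrite ai leqNgt ir.
have an := leq_trans ar hrn; have ap := leq_trans ar hrp.
have bn := leq_trans br hrn; have bp := leq_trans br hrp.
have -> := mxeE (crossmx i z) (Ordinal an) (Ordinal bp).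
have -> := mxeE (crossmx i z) (Ordinal bn) (Ordinal ap).
rewrite !mxE -!val_eqE /= ar br /=.
have -> : mxe z 0 a = z 0 (Ordinal ap) by exact: (mxeE z 0 (Ordinal ap)).
have -> : mxe z 0 b = z 0 (Ordinal bp) by exact: (mxeE z 0 (Ordinal bp)).
case: (eqVneq a i) => [ai | ai]; case: (eqVneq b i) => [bi | bi] //.
by congr (z 0 _); apply: val_inj; rewrite /= ai bi.
Qed.

Section Separation.
Variables (Q0 : 'M[K]_(p, q)) (R : K -> 'rV[K]_q).
Hypothesis RL : root_linear R.
Hypothesis FE : forall M, inSvM r M -> F M = M *m Q0 + diagrows r R M.

(** The left-hand side is row [i] of [F (crossmx i y)], and row [i] of [crossmx i y] is [y]. *)
Lemma row_injective (i : 'I_n) (y : 'rV_p) : (i < r)%N ->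
  y *m Q0 + R (mxe y 0 i) = 0 -> y = 0.
Proof.
move=> ir y0; have SM := crossmx_in y ir; have ip := leq_trans ir hrp.
have rowM : delta_mx 0 i *m crossmx i y = y.
  by rewrite -rowE; apply/rowP=> b; rewrite !mxE eqxx.
have := Fker (delta_mx 0 i) SM; rewrite rowM FE // mulmxDr mulmxA rowM.
suff -> : delta_mx 0 i *m diagrows r R (crossmx i y) = R (mxe y 0 i).
  by rewrite y0 eqxx => /esym/eqP.
rewrite -rowE; apply/rowP=> c; rewrite !mxE ir; congr (R _ 0 c).
rewrite (mxeE (crossmx i y) i (Ordinal ip)) mxE eqxx.
by rewrite -(mxeE y 0 (Ordinal ip)).
Qed.

(* If the first two coordinates of y are nonzero, y = u M for some M in the space
   with u M_diag u^T = 2 y_0 y_1 = 0, where u is supported on the first two rows,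
   so that u F(M) = y Q0. *)
Lemma coords_injective (y : 'rV_p) : y *m Q0 = 0 -> y = 0.
Proof.
move=> yQ0; have r0 : (0 < r)%N by apply: ltnW.
pose p0 : 'I_p := Ordinal (leq_trans r0 hrp).
pose p1 : 'I_p := Ordinal (leq_trans hr2 hrp).
(* A zero coordinate makes the root term [R 0 = 0], so one row suffices. *)
have nz0 : y 0 p0 = 0 -> y = 0.
  move=> y0; apply: (@row_injective o0) => //.
  by rewrite (mxeE y 0 p0) y0 (root_linear0 RL) yQ0 addr0.
have nz1 : y 0 p1 = 0 -> y = 0.
  move=> y1; apply: (@row_injective o1) => //.
  by rewrite (mxeE y 0 p1) y1 (root_linear0 RL) yQ0 addr0.
have [/nz0 // | y0] := eqVneq (y 0 p0) 0.
have [/nz1 // | y1] := eqVneq (y 0 p1) 0.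
(* Rows 0 and 1 of [M] are [z] and [(y_1 / y_0) e_1], with diagonal entries [y_0 / y_1] and
   [y_1 / y_0]. *)
pose z : 'rV_p := \row_b (if b == p1 then 0 else y 0 b / y 0 p1).
pose M := crossmx o0 z + symE 1 1 (y 0 p1 / y 0 p0).
have SM : inSvM r M.
  by apply: inSvMD; [apply: crossmx_in | apply: symE_in; rewrite hr2 orbT].
pose u : 'rV_n := y 0 p1 *: delta_mx 0 o0 + y 0 p0 *: delta_mx 0 o1.
have uM : u *m M = y.
  rewrite mulmxDl -!scalemxAl -!rowE; apply/rowP=> b.
  rewrite !mxE (mxeE z 0 p1) !mxE /= hr2 /= !orbb if_same.
  have [-> | b1] := eqVneq b p1.
    by rewrite /= addr0 mulr0 !add0r mulrC divfK.
  rewrite (negPf (b1 : b != 1 :> nat)) !addr0 mulr0 addr0.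
  by rewrite mulrC divfK.
rewrite -uM; apply/eqP; rewrite -Fker // FE // mulmxDr mulmxA uM yQ0 add0r.
rewrite mul_diagrows // (bigD1 o0) //= (bigD1 o1) //= ?hr2 // big1 => [|i]; last first.
  by case/andP=> /andP[_ i0] i1; rewrite !mxE (negPf i0) (negPf i1) !mulr0 addr0 expr0n mul0r.
rewrite (mxeE M o0 p0) (mxeE M o1 p1) !mxE (mxeE z 0 p1) !mxE /= hr2 /= ?mulr0 ?mulr1 ?addr0 ?add0r.
rewrite (_ : _ + _ = 0) ?root_linear0 //.
transitivity ((1 + 1) * (y 0 p0 * y 0 p1)); last by rewrite addxx mul0r.
by field; rewrite y0.
Qed.

(* Rescaling y by y_k / t turns [y *m Q0 = R t] into the vanishing of row k of F
   on a matrix with row k proportional to y. *)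
Lemma root_range_sep (y : 'rV_p) (t : K) : y *m Q0 = R t ->
  forall k : 'I_p, (k < r)%N -> y 0 k = 0.
Proof.
move=> yR k kr; have kn := leq_trans kr hrn.
have [t0 | t0] := eqVneq t 0.
  by rewrite (coords_injective (y := y)) ?mxE // yR t0 root_linear0.
apply/eqP/negPn/negP=> yk; pose l := y 0 k / t.
have ly0 : l *: y = 0.
  apply: (@row_injective (Ordinal kn)) => //=.
  rewrite (mxeE (l *: y) 0 k) mxE -scalemxAl yR.
  (* With this [l], [R (l y_k) = l R(t)] cancels [l y Q0]. *)
  have -> : l * y 0 k = l ^+ 2 * t by rewrite /l; field.
  by case: RL => _ ->; rewrite -scalerDl addxx scale0r.
have /rowP/(_ k) := ly0; rewrite !mxE => /eqP.
by rewrite !mulf_eq0 invr_eq0 (negPf yk) (negPf t0).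
Qed.

End Separation.
End Structure.

(** * Passage to and from the standard form *)

Lemma padmxE (K : fieldType) (n p d : nat) (M : 'M[K]_(n, p)) :
  padmx (p + d) M = row_mx M 0.
Proof.
apply/matrixP=> i j; rewrite mxE -(splitK j).
case: (split j) => k /=; rewrite ?row_mxEl ?row_mxEr; first exact: mxeE.
by rewrite mxE /mxe valK insubF // ltnNge leq_addr.
Qed.

Lemma rootpartE (K : fieldType) (n p q r : nat) (R : K -> 'rV[K]_(q - r)) (M : 'M[K]_(n, p)) :
  rootpart r R M = diagrows r (fun t => \row_j (if (r <= j)%N then mxe (R t) 0 (j - r) else 0)) M.
Proof. by apply/matrixP=> i j; rewrite !mxE; case: ltnP; case: leqP. Qed.

Lemma padroot_linear (K : fieldType) (q r : nat) (R : K -> 'rV[K]_(q - r)) : root_linear R ->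
  root_linear (fun t => \row_(j < q) (if (r <= j)%N then mxe (R t) 0 (j - r) else 0)).
Proof.
move=> [RD RZ]; split=> [x y | l x]; apply/rowP=> j; rewrite !mxE; case: leqP => rj.
- by rewrite RD mxeD.
- by rewrite addr0.
- have jq : (j - r < q - r)%N by rewrite ltn_sub2r ?(leq_ltn_trans rj).
  by rewrite RZ !(mxeE _ 0 (Ordinal jq)) mxE.
- by rewrite mulr0.
Qed.

Lemma mul_diagrowsr (K : fieldType) (n p q m r : nat) (R : K -> 'rV[K]_q) (M : 'M[K]_(n, p))
    (Q : 'M_(q, m)) :
  diagrows r R M *m Q = diagrows r (fun t => R t *m Q) M.
Proof.
apply/matrixP=> i j; rewrite !mxE; case: ifP => ir.
  by apply: eq_bigr => k _; rewrite mxE ir.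
by apply: big1 => k _; rewrite mxE ir mul0r.
Qed.

Lemma range_preservingP (K : fieldType) (n p q r : nat) (F : 'M[K]_(n, p) -> 'M[K]_(n, q)) :
  range_preserving_on r F <->
  forall (M : 'M_(n, p)) (u : 'rV_n), inSvM r M -> (u *m F M == 0) = (u *m M == 0).
Proof.
split=> [rgF M u SM | kerF M SM].
  have /andP[/submx_tr_ker FM /submx_tr_ker MF] := rgF M SM.
  by apply/eqP/eqP; auto.
by apply/andP; split; apply/submx_tr_ker=> u /eqP uM0; apply/eqP;
  [rewrite kerF | rewrite -kerF].
Qed.

Lemma diagrowsD (K : fieldType) (n p q r : nat) (R : K -> 'rV[K]_q) (M N : 'M[K]_(n, p)) :
  root_linear R -> diagrows r R (M + N) = diagrows r R M + diagrows r R N.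
Proof.
move=> [RD _]; apply/matrixP=> i j; rewrite !mxE; case: ifP; rewrite ?addr0 //.
by rewrite mxeD RD mxE.
Qed.

(** The invertible [Q] does not change left kernels. For [J = [I 0]] the criterion [diagrows_ker]
    applies, since the padded [R'] vanishes on the first [r] coordinates. *)
Lemma inSvM_standard (K : fieldType) (n p r d : nat) (hchar : 2%N \in [pchar K])
    (hrp : (r <= p)%N) (Q : 'M[K]_(p + d)) (R : K -> 'rV[K]_(p + d - r))
    (F : 'M[K]_(n, p) -> 'M[K]_(n, p + d)) :
  Q \in unitmx -> root_linear R ->
  (forall M, inSvM r M -> F M = (padmx (p + d) M + rootpart r R M) *m Q) ->
  additive_on r F /\ range_preserving_on r F.
Proof.
move=> Qu RL FE; have RL' := padroot_linear RL.
set R' := (fun t => _) in RL'.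
pose J : 'M[K]_(p, p + d) := row_mx 1%:M 0.
have FE' M : inSvM r M -> F M = (M *m J + diagrows r R' M) *m Q.
  by move=> SM; rewrite FE // rootpartE padmxE mul_mx_row mulmx1 mulmx0.
split=> [M N SM SN | ].
  rewrite !FE' //; last exact: inSvMD.
  by rewrite diagrowsD // -mulmxDl (mulmxDl M N) addrACA.
apply/range_preservingP => M u SM.
rewrite FE' // mulmxA (can2_eq (mulmxK Qu) (mulmxKV Qu)) mul0mx.
apply: (diagrows_ker hchar) => // [y t /rowP yJ k kr | y /rowP yJ].
  have := yJ (lshift d k); rewrite mul_mx_row mulmx1 row_mxEl => ->.
  by rewrite mxE leqNgt kr.
by apply/rowP=> k; have := yJ (lshift d k); rewrite mul_mx_row mulmx1 row_mxEl => ->; rewrite !mxE.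
Qed.

(** [Q] is [Q0] completed by rows [N] such that the image of [R] lies in the span of the last
    [q - r] rows; [R'] gives the coordinates of [R] there. *)
Lemma standard_form (K : fieldType) (n p q r : nat) (Q0 : 'M[K]_(p, q)) (R : K -> 'rV[K]_q) :
    (r <= p)%N -> root_linear R ->
    (forall y : 'rV_p, y *m Q0 = 0 -> y = 0) ->
    (forall (y : 'rV_p) t, y *m Q0 = R t -> forall k : 'I_p, (k < r)%N -> y 0 k = 0) ->
  (p <= q)%N /\ exists (Q : 'M[K]_q) (R' : K -> 'rV[K]_(q - r)),
    Q \in unitmx /\ root_linear R' /\
    forall M : 'M_(n, p), M *m Q0 + diagrows r R M = (padmx q M + rootpart r R' M) *m Q.
Proof.
move=> rp RL freeQ0 sepR.
have rfQ0 : row_free Q0.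
  rewrite -kermx_eq0; apply/eqP/row_matrixP=> i; rewrite row0; apply: freeQ0.
  by rewrite -row_mul mulmx_ker row0.
have pq : (p <= q)%N by rewrite -(eqP rfQ0) rank_leq_col.
split=> //.
have [s ps] : exists s, p = (r + s)%N by exists (p - r)%N; rewrite subnKC.
have [d qd] : exists d, q = (p + d)%N by exists (q - p)%N; rewrite subnKC.
subst q; subst p.
have [G GE] : exists G : 'M_(r + s + d), forall v, (exists t, v = R t) <-> (v <= G)%MS.
  case: (RL) => RD RZ; apply: subspace_rowspace.
  - by exists 0; rewrite root_linear0.
  - by move=> _ _ [t ->] [t' ->]; exists (t + t').
  (* Root-linearity makes the image of [R] a subspace: [a R(t) = R(a^2 t)]. *)
  - by move=> a _ [t ->]; exists (a ^+ 2 * t).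
have sepG (y : 'rV_r) (z : 'rV_s) :
    ((y *m usubmx Q0 + z *m dsubmx Q0)%R <= G)%MS -> y = 0.
  move/GE=> [t]; rewrite -mul_row_col vsubmxK => /sepR yz.
  by apply/rowP=> k; have := yz (lshift s k) (ltn_ord k); rewrite row_mxEl mxE.
have [|N [Qu NG]] := extend_rows _ sepG; first by rewrite vsubmxK.
rewrite vsubmxK in Qu; set Q := col_mx Q0 N in Qu.
exists Q.
pose R1 t := R t *m invmx Q.
have R1L : root_linear R1.
  by case: RL => RD RZ; split=> [x y | l x]; rewrite /R1 ?RD ?RZ ?mulmxDl ?scalemxAl.
(* [R1 t] lists the coordinates of [R t] in the basis [Q]; those along the first [r] rows vanish by
   the choice of [N]. *)
have R10 t (j : 'I_(r + s + d)) : (j < r)%N -> R1 t 0 j = 0.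
  move=> jr; have [w Rw] : exists w, R t = w *m col_mx (dsubmx Q0) N.
    by apply: NG; apply/GE; exists t.
  have -> : R1 t = row_mx (row_mx 0 (lsubmx w)) (rsubmx w).
    rewrite /R1 -[RHS](mulmxK Qu); congr (_ *m _).
    rewrite Rw /Q -[in RHS](vsubmxK Q0) !mul_row_col mul0mx add0r.
    by rewrite -[in LHS](hsubmxK w) mul_row_col.
  have -> : j = lshift d (lshift s (Ordinal jr)) by apply: val_inj.
  by rewrite !row_mxEl mxE.
pose R' t : 'rV[K]_(r + s + d - r) := \row_j mxe (R1 t) 0 (r + j).
have shiftP (j : 'I_(r + s + d - r)) : (r + j < r + s + d)%N by rewrite -ltn_subRL ltn_ord.
exists R'; split=> //; split.
  case: R1L => RD RZ; split=> [x y | l x]; apply/rowP=> j; rewrite !mxE.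
    by rewrite RD mxeD.
  by rewrite RZ !(mxeE _ 0 (Ordinal (shiftP j))) mxE.
have R'E t : (\row_(j < r + s + d) (if (r <= j)%N then mxe (R' t) 0 (j - r) else 0)) *m Q = R t.
  rewrite -[RHS](mulmxKV Qu) -/(R1 t); congr (_ *m _).
  apply/rowP=> j; rewrite mxE; case: leqP => rj; last by rewrite R10.
  have jq : (j - r < r + s + d - r)%N by rewrite ltn_sub2r ?(leq_ltn_trans rj).
  by rewrite (mxeE _ 0 (Ordinal jq)) mxE /= subnKC // (mxeE _ 0 j).
move=> M; rewrite mulmxDl padmxE mul_row_col mul0mx addr0; congr (_ + _).
rewrite rootpartE mul_diagrowsr; apply/matrixP=> i c.
by rewrite [LHS]mxE [RHS]mxE R'E.
Qed.

(** * Characterization of the range-preserving homomorphisms *)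

Theorem theorem7p7 (K : fieldType) (n p r q : nat)
  (hchar : 2%N \in [pchar K])
  (hr2 : (2 <= r)%N) (hrn : (r <= n)%N) (hrp : (r <= p)%N) (hq : (1 <= q)%N)
  (F : 'M[K]_(n, p) -> 'M[K]_(n, q)) :
  (additive_on r F /\ range_preserving_on r F) <->
  ((p <= q)%N /\
   exists (Q : 'M[K]_q) (R : K -> 'rV[K]_(q - r)),
     Q \in unitmx /\ root_linear R /\
     forall M : 'M[K]_(n, p), inSvM r M ->
       F M = (padmx q M + rootpart r R M) *m Q).
Proof.
split=> [[FD /range_preservingP Fker] | [pq [Q [R [Qu [RL FE]]]]]]; last first.
  have [d qd] : exists d, q = (p + d)%N by exists (q - p)%N; rewrite subnKC.
  by subst q; apply: inSvM_standard FE.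
have RL := rootrow_linear hchar hr2 hrn hrp FD Fker.
have FE := hom_structure hchar hr2 hrn hrp FD Fker.
have inj := coords_injective hchar hr2 hrn hrp Fker RL FE.
have sep := root_range_sep hchar hr2 hrn hrp Fker RL FE.
have [pq [Q [R [Qu [R'L QE]]]]] := @standard_form K n p q r _ _ hrp RL inj sep.
by split=> //; exists Q, R; do 2!split=> //; move=> M SM; rewrite FE // QE.
Qed.
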